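(* Let $(\mathbb{R},\mathcal{P})$ be the category base of all perfect sets in $\mathbb{R}$, and let $E\subseteq\mathbb{R}$ be Marczewski abundant, i.e. abundant in $(\mathbb{R},\mathcal{P})$. Then there exists an ARD set $F$ which is a full subset of $E$ in $(\mathbb{R},\mathcal{P})$.
   Context: **The family of perfect sets.** $\mathcal{P}$ is the family of all (non-empty) perfect subsets of $\mathbb{R}$, i.e. non-empty closed sets without isolated points. The pair $(\mathbb{R},\mathcal{P})$ is a category base in the sense of Morgan, whose regions are the members of $\mathcal{P}$; a subregion of a region $P$ is a region contained in $P$. **Singular, meager, abundant, Baire.** In $(\mathbb{R},\mathcal{P})$, a set $A\subseteq\mathbb{R}$ is singular if every region contains a subregion disjoint from $A$; meager if it is a countable union of singular sets; abundant if it is not meager; Baire if every region contains a subregion $D$ such that $D\cap A$ or $D\setminus A$ is meager. For this particular category base, these are called Marczewski meager, Marczewski abundant and Marczewski Baire sets. **ARD set.** A subset of $\mathbb{R}$ is ARD (''avoiding rational distances'') if the distance between any two distinct points of it is irrational. **Full subset.** A set $F$ is a full subset of $E$ in $(\mathbb{R},\mathcal{P})$ if $F\subseteq E$ and for every Marczewski Baire set $B$, $B\cap F$ is Marczewski abundant whenever $B\cap E$ is Marczewski abundant. *)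

(* Defs.v *)
From mathcomp Require Import all_boot all_order all_algebra.
From mathcomp Require Import all_classical all_reals all_analysis.

Set Implicit Arguments.
Unset Strict Implicit.
Unset Printing Implicit Defensive.

Import Order.TTheory GRing.Theory Num.Theory.
Import numFieldNormedType.Exports.

Local Open Scope classical_set_scope.
Local Open Scope ring_scope.

(* Morgan's notions relative to the pair (T, C), where C : set (set T) is the
   family of regions. *)

Definition cb_singular (T : Type) (C : set (set T)) (A : set T) : Prop :=
  forall P, C P -> exists D, [/\ C D, D `<=` P & D `&` A = set0].

Definition cb_meager (T : Type) (C : set (set T)) (A : set T) : Prop :=
  exists S : nat -> set T,
    (forall n, cb_singular C (S n)) /\ A = \bigcup_n S n.

Definition cb_abundant (T : Type) (C : set (set T)) (A : set T) : Prop :=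
  ~ cb_meager C A.

Definition cb_baire (T : Type) (C : set (set T)) (A : set T) : Prop :=
  forall P, C P -> exists D,
    [/\ C D, D `<=` P & cb_meager C (D `&` A) \/ cb_meager C (D `\` A)].

Definition cb_full_subset (T : Type) (C : set (set T)) (F E : set T) : Prop :=
  F `<=` E /\
  forall B, cb_baire C B -> cb_abundant C (B `&` E) -> cb_abundant C (B `&` F).

Definition perfect_regions (R : realType) : set (set R) :=
  [set P | P !=set0 /\ perfect_set P].

Definition ARD (R : realType) (A : set R) : Prop :=
  forall x y, A x -> A y -> x != y -> irrational `|x - y|.

(* Main.v *)
(* The classical transfinite construction: list the perfect sets P such that E
   meets every perfect subset of P, and pick x_a in E meeting the a-th one, at an
   irrational distance from all earlier choices. F = {x_a} meets each such P.
   By fusion, meager sets are singular, so a Marczewski Baire set B with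
   B & E abundant contains a perfect set all of whose perfect subsets meet E,
   hence meet F; so B & F is not singular.
   A choice is always possible because P contains 2^omega pairwise disjoint
   perfect sets: otherwise the points of E in these sets, each lying in one of
   countably many translates of an earlier choice, would give a
   countable-to-one map from 2^omega into a proper initial segment of a
   well-order of minimal type on 2^omega. *)

Require Import Defs.
From mathcomp Require Import all_boot all_order all_algebra.
From mathcomp Require Import all_classical all_reals all_analysis.
From mathcomp Require Import lra.

Set Implicit Arguments.
Unset Strict Implicit.
Unset Printing Implicit Defensive.

Import Order.TTheory GRing.Theory Num.Theory.
Import numFieldNormedType.Exports.

Local Open Scope classical_set_scope.
Local Open Scope ring_scope.

(** * Well-orders, and counting on 2^omega *)

Lemma well_founded_of_wo (X : eqType) (R : rel X) : wochoice.well_order R ->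
  [/\ well_founded (fun x y => ~~ R y x), total R & antisymmetric R].
Proof.
move=> wo; split.
- move=> x; apply: contrapT => nx.
  have [|z [[/asboolP nz lz] _]] := wo [pred y | `[< ~ Acc (fun x y => ~~ R y x) y >]].
    by exists x; apply/asboolP.
  apply: nz; constructor => y nzy; apply: contrapT => ny.
  by move: nzy; rewrite lz //; apply/asboolP.
- move=> x y; have [|z [[/orP zxy lz] _]] := wo [pred z | (z == x) || (z == y)].
    by exists x; rewrite inE eqxx.
  have Rzx : R z x by apply: lz; rewrite inE eqxx.
  have Rzy : R z y by apply: lz; rewrite inE eqxx orbT.
  by case: zxy => /eqP zE; rewrite -zE ?Rzx ?Rzy ?orbT.
- move=> x y /andP[Rxy Ryx].
  have Rxx a : R a a.
    have [|z [[/eqP -> lz] _]] := wo (pred1 a); first by exists a; rewrite inE.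
    by apply: lz; rewrite inE.
  (* Both points are least in the pair, and least elements are unique. *)
  have [|z [_ uz]] := wo (pred2 x y); first by exists x; rewrite inE eqxx.
  rewrite -(uz x) ?(uz y) //; split; rewrite ?inE ?eqxx ?orbT// => w.
    by rewrite inE => /orP[] /eqP ->.
  by rewrite inE => /orP[] /eqP ->.
Qed.

(** If X injects into proper initial segments, the least such segment gives an injection [i]. In the
    order pulled back along [i], a segment that received X would give one below some [i y], against
    the minimality of [z]. *)
Lemma initial_well_order (X : Type) : exists lt : X -> X -> Prop,
  [/\ well_founded lt,
      (forall x y, lt x y \/ x = y \/ lt y x) &
      forall x (f : X -> X), injective f -> ~ (forall t, lt (f t) x)].
Proof.
have [R /well_founded_of_wo[wfR totR antiR]] :=
  wochoice.well_ordering_principle {classic X}.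
pose lt (x y : X) := ~~ R y x.
have tri x y : lt x y \/ x = y \/ lt y x.
  rewrite /lt; case Rxy : (R x y); case Ryx : (R y x); [|by left|by right; right|].
    by right; left; apply: antiR; rewrite Rxy.
  by have := totR x y; rewrite Rxy Ryx.
pose bad x := exists2 f : X -> X, injective f & forall t, lt (f t) x.
have [[x badx]|nbad] := pselect (exists x, bad x); last first.
  exists lt; split => // x f finj ltfx.
  by apply: nbad; exists x; exists f.
have {badx} [z [[i iinj iz] zmin]] : exists z, bad z /\ forall y, lt y z -> ~ bad y.
  elim/(well_founded_ind wfR) : x badx => x IH badx.
  have [[y [yx /(IH _ yx)//]]|nex] := pselect (exists y, lt y x /\ bad y).
  by exists x; split => // y yx bady; apply: nex; exists y.
exists (fun x y => lt (i x) (i y)); split.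
- suff acc y : Acc lt y -> forall t, i t = y -> Acc (fun x y => lt (i x) (i y)) t.
    by move=> t; exact: (acc (i t)).
  elim=> {}y _ IH t iE; constructor => s; rewrite iE => ltsy.
  exact: IH ltsy s erefl.
- by move=> s t; have [|[/iinj ->|]] := tri (i s) (i t); tauto.
- move=> y f finj fy; apply: (zmin (i y)) => //.
  by exists (i \o f) => //; apply: inj_comp.
Qed.

(* Konig's argument: 2^omega = (2^omega)^omega is covered by the sets r @^-1 n, so
   one of them projects onto the n-th factor. *)
Lemma konig_cantor (Y : Type) (h : (nat -> bool) -> Y) (r : (nat -> bool) -> nat) :
  (forall s t, h s = h t -> r s = r t -> s = t) ->
  exists i : (nat -> bool) -> nat -> bool, injective (h \o i).
Proof.
move=> hr; pose d (t : nat -> bool) (n k : nat) := t (pickle (n, k)).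
have [[n nP]|noN] := pselect (exists n, forall u, exists t, r t = n /\ d t n = u).
  have [i iP] := choice nP.
  exists i => u v /= huv; rewrite -(iP u).2 -(iP v).2.
  by rewrite (hr _ _ huv) // (iP u).1 (iP v).1.
have nP n : exists u, forall t, r t = n -> d t n <> u.
  apply: contrapT => H; apply: noN; exists n => u.
  apply: contrapT => H'; apply: H; exists u => t rt dt; apply: H'.
  by exists t.
have [u uP] := choice nP.
(* Diagonal point: its n-th factor is the value [u n] that no point of the fibre of [r] over n has
   there. *)
pose t k := if unpickle k is Some (n, m) then u n m else false.
exfalso; apply: (uP (r t) t erefl).
by apply: funext => k; rewrite /d /t pickleK.
Qed.

(** * Perfect sets and Cantor space *)

Lemma perfect_range (T : topologicalType) (f : cantor_space -> T) :
  hausdorff_space T -> continuous f -> injective f -> perfect_set (range f).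
Proof.
move=> hT cf finj.
have clf : closed (range f).
  apply: (compact_closed hT); apply: continuous_compact.
    exact: continuous_subspaceT.
  exact: cantor_space_compact.
split=> //; apply/seteqP; split => [x /subset_limit_point /clf//|_ [a _ <-]].
move=> U /(cf a) fU; have : limit_point [set: cantor_space] a by rewrite cantor_perfect.2.
move=> /(_ _ fU)[b [ba _ Ub]].
exists (f b); split => //.
by apply: contra ba => /eqP /finj ->.
Qed.

(** A point isolated in the intersection would be isolated in P, since U is open; all other points
    of the closure are limit points already. *)
Lemma perfect_closure_openI (T : topologicalType) (P U : set T) :
  perfect_set P -> open U -> perfect_set (closure (P `&` U)).
Proof.
move=> [_ limP] oU; have cl := @closed_closure _ (P `&` U); split=> //.
apply/seteqP; split => [x /subset_limit_point /cl//|x].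
rewrite {1}closure_isolated_limit_point => -[[/set_mem [Px Ux] [V xV VPU]]|].
  have : limit_point P x by rewrite limP.
  move=> /(_ (V `&` U)) [|y [yx Py [Vy Uy]]].
    by apply: filterI => //; exact: open_nbhs_nbhs.
  have : (V `&` (P `&` U)) y by [].
  by rewrite VPU => /eqP; rewrite (negbTE yx).
move=> lx V /lx [y [yx PUy Vy]]; exists y; split => //; exact/subset_closure.
Qed.

Lemma near_prefix (a : cantor_space) n :
  \forall b \near a, forall i, (i < n)%N -> a i = b i.
Proof.
have near1 i : \forall b \near a, a i = b i.
  apply: (@proj_continuous _ (fun=> bool) i a [set y | a i = y]).
  by apply: open_nbhs_nbhs; split=> //; exact: discrete_open.
elim: n => [|n IH]; first by apply: filterS filterT => b _ i; rewrite ltn0.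
apply: filterS2 IH (near1 n) => b ab abn i.
by rewrite ltnS leq_eqVlt => /predU1P[->//|/ab].
Qed.

(** * Fusion of perfect sets *)

Section regions.
Context {R : realType}.
Local Notation reg := (@perfect_regions R).
Local Notation singular := (cb_singular reg).

(** Singularity is applied not to P but to the closure of its part in a small ball, which is again
    perfect. *)
Lemma small_subregion (P S : set R) (x e : R) :
  reg P -> singular S -> P x -> 0 < e ->
  exists D, [/\ reg D, D `<=` P, D `&` S = set0 & D `<=` closed_ball x e].
Proof.
move=> [_ pP] sS Px e0.
have [|D [rD DPx DS]] := sS (closure (P `&` ball x e)).
  split; last by apply: perfect_closure_openI => //; exact: ball_open.
  by exists x; apply: subset_closure; split => //; exact: ballxx.
exists D; split => //.
  move=> y /DPx /closureI [+ _].
  by case: pP => /closure_id <-.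
by move=> y /DPx /closureI [_ ?].
Qed.

Lemma split_region (P S : set R) (e : R) : reg P -> singular S -> 0 < e ->
  exists D : bool -> set R,
    (forall b, [/\ reg (D b), D b `<=` P, D b `&` S = set0 &
                   forall x y, D b x -> D b y -> `|x - y| <= e]) /\
    (forall x, D true x -> D false x -> False).
Proof.
move=> rP sS e0; have [[x Px] [_ limP]] := rP.
have : limit_point P x by rewrite limP.
move=> /(_ setT filterT) [y [yx Py _]].
(* The half bounds the diameters by [e]; the third keeps the balls around x and y disjoint. *)
pose d := Num.min (e / 2) (`|x - y| / 3).
have xy0 : 0 < `|x - y| by rewrite normr_gt0 subr_eq0 eq_sym.
have d0 : 0 < d by rewrite lt_min !divr_gt0.
have [D1 [r1 P1 S1 B1]] := small_subregion rP sS Px d0.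
have [D0 [r0 P0 S0 B0]] := small_subregion rP sS Py d0.
have bd (c u v : R) : closed_ball c d u -> closed_ball c d v -> `|u - v| <= e.
  rewrite closed_ballE // /closed_ball_ /= => cu cv.
  rewrite (le_trans (ler_distD c _ _))// distrC (le_trans (lerD cu cv))//.
  have : d <= e / 2 by rewrite /d ge_min lexx.
  by lra.
exists (fun b => if b then D1 else D0); split.
  by case; split => // u v; [move=> /B1 + /B1|move=> /B0 + /B0]; exact: bd.
move=> z /B1 + /B0; rewrite !closed_ballE // /closed_ball_ /= => xz yz.
have : d <= `|x - y| / 3 by rewrite /d ge_min lexx orbT.
have := ler_distD z x y; rewrite (distrC z y).
by move: xy0 xz yz; lra.
Qed.

(** A Cantor scheme: pieces of level n+1 avoid [S n] and have diameter at most 1/(n+1), and siblings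
    are disjoint. Sending a branch to a point common to its pieces is continuous by the first bound
    and injective by disjointness. *)
Lemma fusion (P : set R) (S : nat -> set R) :
  reg P -> (forall n, singular (S n)) ->
  exists f : cantor_space -> R,
  [/\ continuous f, injective f, range f `<=` P &
      forall n, range f `&` S n = set0].
Proof.
move=> rP sS.
have split n Q : exists D : bool -> set R, reg Q ->
    (forall b, [/\ reg (D b), D b `<=` Q, D b `&` S n = set0 &
       forall x y, D b x -> D b y -> `|x - y| <= n.+1%:R^-1]) /\
    (forall x, D true x -> D false x -> False).
  (* Outside the regions a dummy value makes [D] total, so that choice applies. *)
  have [rQ|nrQ] := pselect (reg Q); last by exists (fun=> set0).
  have [|D DP] := @split_region Q (S n) n.+1%:R^-1 rQ (@sS n).
    by rewrite invr_gt0.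
  by exists D.
have {split} [D DP] := choice (fun nQ : nat * set R => split nQ.1 nQ.2).
pose fix br (a : cantor_space) n :=
  if n is m.+1 then D (m, br a m) (a m) else P.
have rbr a n : reg (br a n).
  by elim: n => //= n IH; have [/(_ (a n))[]] := DP (n, br a n) IH.
have brP a n := DP (n, br a n) (rbr a n).
have brS a n : br a n.+1 `<=` br a n by have [/(_ (a n))[]] := brP a n.
have br_le a m n : (m <= n)%N -> br a n `<=` br a m.
  move=> /subnK <-; elim: (n - m)%N => // k IH.
  by rewrite addSn; apply: subset_trans (brS _ _) IH.
have br_pre a b n : (forall i, (i < n)%N -> a i = b i) -> br a n = br b n.
  elim: n => //= n IH ab; rewrite IH ?ab // => i /ltnW; exact: ab.
(* Level 0 is P, which may be unbounded; level 1 has diameter at most 1. *)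
have cptbr a : compact (br a 1%N).
  have [/(_ (a 0%N))[[_ [cl _]] _ _ bnd] _] := brP a 0%N.
  have [[x Dx] _] := rbr a 1%N.
  apply: (subclosed_compact cl (@segment_compact _ (x - 1) (x + 1))).
  move=> y Dy; have := bnd x y Dx Dy; rewrite invr1 ler_norml /= in_itv /=.
  by move=> /andP[]; lra.
have ex_pt a : exists x, forall n, br a n x.
  have brF : ProperFilter (filter_from [set: nat] (br a)).
    apply: filter_from_proper; last by move=> n _; exact: (rbr a n).1.
    apply: filter_from_filter; first by exists 0%N.
    move=> i j _ _; exists (maxn i j) => //; rewrite subsetI.
    by split; apply: br_le; [exact: leq_maxl | exact: leq_maxr].
  have [|x [_ clx]] := cptbr a _ brF; first by exists 1%N.
  exists x => n; have [_ [/closure_id -> _]] := rbr a n.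
  by move: clx; rewrite clusterE; apply; exists n.
have [f fP] := choice ex_pt.
exists f; split.
- move=> a; apply/cvgrPdist_le => e e0.
  have [n ne] : exists n, n.+1%:R^-1 <= e.
    exists (Num.truncn e^-1); rewrite invf_ple ?posrE// ltW//.
    exact: truncnS_gt.
  near=> b.
  have /br_pre brE : forall i, (i < n.+1)%N -> a i = b i by near: b; exact: near_prefix.
  apply: le_trans ne; have [/(_ (a n))[_ _ _ bnd] _] := brP a n.
  by apply: bnd; [exact: (fP a n.+1) | rewrite -/(br a n.+1) brE].
- move=> a b fab; apply: funext => n.
  elim/ltn_ind: n => n /br_pre brE.
  have := fP a n.+1; have := fP b n.+1; rewrite fab /= brE.
  have [_ dis] := brP b n.
  by case: (a n) (b n) => [] [] // ? ?; case: (dis (f b)).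
- by move=> _ [a _ <-]; exact: (fP a 0%N).
- move=> n; apply/seteqP; split => // _ [[a _ <-] Sf].
  have [/(_ (a n))[_ _ <- _] _] := brP a n.
  by split => //; exact: (fP a n.+1).
Unshelve. all: end_near. Qed.

Lemma reg_range (f : cantor_space -> R) :
  continuous f -> injective f -> reg (range f).
Proof.
move=> cf finj; split; first by exists (f point); exists point.
by apply: perfect_range => //; exact: Rhausdorff.
Qed.

Lemma meager_singular (A : set R) : cb_meager reg A -> singular A.
Proof.
move=> [S [sS ->]] P rP; have [f [cf finj fP fS]] := fusion rP sS.
exists (range f); split => //; first exact: reg_range.
by rewrite setI_bigcupr; apply: bigcup0 => n _.
Qed.

Lemma singular_meager (A : set R) : singular A -> cb_meager reg A.
Proof.
by move=> sA; exists (fun=> A); split => //; rewrite bigcup_const //; exists 0%N.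
Qed.

Lemma singular0 : singular set0.
Proof. by move=> P rP; exists P; split => //; rewrite setI0. Qed.

(** * Families of closed sets indexed by 2^omega *)

Lemma disjoint_subregions (P : set R) : reg P ->
  exists Q : (nat -> bool) -> set R,
    (forall t, reg (Q t) /\ Q t `<=` P) /\
    (forall s t x, Q s x -> Q t x -> s = t).
Proof.
move=> rP; have [f [cf finj fP _]] := fusion rP (fun=> singular0).
(* Cantor space is its own square: odd coordinates carry the label [t], even ones run over a copy of
   Cantor space. *)
pose mix (t : nat -> bool) (a : cantor_space) : cantor_space :=
  fun n => if odd n then t n./2 else a n./2.
have mix_odd t a n : mix t a n.*2.+1 = t n.
  by rewrite /mix /= odd_double /= uphalf_double.
have mix_even t a n : mix t a n.*2 = a n by rewrite /mix odd_double doubleK.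
have mix_cts t : continuous (mix t).
  move=> a; apply/cvg_sup => n U [_ [[W oW <-] Wn WU]].
  apply: (filterS WU); rewrite nbhs_simpl /=.
  near=> b; suff mixE : mix t a n = mix t b n by change (W (mix t b n)); rewrite -mixE.
  rewrite /mix; case: ifP => // _.
  have : forall i, (i < n./2.+1)%N -> a i = b i by near: b; exact: near_prefix.
  exact.
exists (fun t => range (f \o mix t)); split.
- move=> t; split; last by move=> _ [a _ <-]; apply: fP; exists (mix t a).
  apply: reg_range.
    by move=> a; apply: continuous_comp; [exact: mix_cts|exact: cf].
  move=> a b /finj ab; apply: funext => n.
  by rewrite -(mix_even t a) ab mix_even.
- move=> s t _ [a _ <-] [b _ /finj ba]; apply: funext => n.
  by rewrite -(mix_odd s a) -ba mix_odd.
Unshelve. all: end_near. Qed.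

(** The complement of a closed set is a union of rational intervals, so a set of intervals codes it.
    This lets the well-order on 2^omega list the perfect sets. *)
Lemma closed_codes : exists c : (nat -> bool) -> set R,
  forall C, closed C -> exists t, c t = C.
Proof.
pose B k : set R := if @unpickle (rat * rat)%type k is Some (p, q)
  then `]ratr p, ratr q[%classic else set0.
exists (fun t => ~` \bigcup_(k in [set k | t k]) B k) => C clC.
exists (fun k => `[< B k `&` C = set0 >]); apply/seteqP; split => x; last first.
  move=> Cx [k /= /asboolP BC Bx].
  by have : (B k `&` C) x by []; rewrite BC.
move=> nBx; apply: contrapT => nCx; apply: nBx.
have : nbhs x (~` C) by apply: open_nbhs_nbhs; split=> //; exact: closed_openC.
move=> /nbhs_ballP[e /= e0 eC].
have [p pP] := @rat_in_itvoo R (x - e) x ltac:(lra).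
have [q qP] := @rat_in_itvoo R x (x + e) ltac:(lra).
move: pP qP; rewrite !in_itv /= => /andP[p1 p2] /andP[q1 q2].
exists (pickle (p, q)); last by rewrite /B pickleK /= in_itv /= p2 q1.
apply/asboolP/seteqP; split => // y [].
rewrite /B pickleK /= in_itv /= => /andP[py yq] Cy.
by apply: (eC y) => //; rewrite /ball /= ltr_norml; apply/andP; split; lra.
Qed.

(** * The transfinite construction *)

Lemma irrational_transversal (I : Type) (E : set R) (lt : I -> I -> Prop)
    (c : I -> set R) : well_founded lt ->
  (forall x y, lt x y \/ x = y \/ lt y x) ->
  exists F : set R, [/\ ARD F, F `<=` E &
    forall x, (forall p : I -> R, exists2 r, (E `&` c x) r &
      forall y, lt y x -> irrational `|r - p y|) -> F `&` c x !=set0].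
Proof.
move=> wf tri.
pose good x (p : forall y, lt y x -> R) r :=
  (E `&` c x) r /\ forall y (yx : lt y x), irrational `|r - p y yx|.
(* A stage without admissible point takes the default 0, which [good] below keeps out of F. *)
pose p := Fix wf (fun=> R) (fun x q => xget 0 (good x q)).
have pE x : p x = xget 0 (good x (fun y _ => p y)).
  rewrite /p Fix_eq // => y q q' qq'; congr (xget 0 (good y _)).
  by apply: functional_extensionality_dep => z; apply: funext => zy.
exists [set r | exists2 x, r = p x & good x (fun y _ => p y) r]; split.
- move=> _ _ [x -> gx] [y -> gy] pxy.
  have [xy|[xy|yx]] := tri x y.
  + by rewrite distrC; apply: gy.2.
  + by rewrite xy eqxx in pxy.
  + exact: gx.2.
- by move=> r [x _ [[]]].
(* The assumption ranges over all sequences because the one built here is internal to the proof. *)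
- move=> x /(_ p)[r Er rp]; have gr : good x (fun y _ => p y) r by [].
  have := xgetPex 0 (ex_intro _ r gr); rewrite -pE => gx.
  by exists (p x); split; [exists x | exact: gx.1.2].
Qed.

Lemma ARD_hitting (E : set R) : exists F : set R, [/\ ARD F, F `<=` E &
  forall P, reg P -> (forall Q, reg Q -> Q `<=` P -> Q `&` E !=set0) ->
    F `&` P !=set0].
Proof.
have [lt [wf tri noinj]] := initial_well_order (nat -> bool).
have [c cP] := closed_codes.
have [F [ardF FE hit]] := irrational_transversal E c wf tri.
exists F; split => // P rP PE.
have [x cx] := cP P rP.2.1; rewrite -cx; apply: hit => p; rewrite cx.
apply: contrapT => no.
have [Q [QP Qdis]] := disjoint_subregions rP.
have /choice[e eP] t : exists r, (Q t `&` E) r by apply: PE; apply QP.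
(* With stage x blocked, each [e t] is at a rational distance from an earlier choice; [h] records
   which one and the distance. *)
have /choice[h hP] t : exists yq : (nat -> bool) * rat,
    lt yq.1 x /\ `|e t - p yq.1| = ratr yq.2.
  apply: contrapT => nex; apply: no; exists (e t).
    by have [Qe Ee] := eP t; split => //; apply: (QP t).2.
  by move=> y yx [q _ qE]; apply: nex; exists (y, q).
(* Distance and side recover [e t] from the earlier choice, and [e t] determines t because the [Q t]
   are disjoint. *)
pose r t := pickle ((h t).2, p (h t).1 <= e t).
have [|i iinj] := @konig_cantor _ (fun t => (h t).1) r.
  move=> s t hst /(pcan_inj pickleK)[qst sgn].
  have est : e s = e t.
    have := (hP s).2; have := (hP t).2; rewrite -qst -hst => <-.
    move: sgn; rewrite -hst; case: (ltP (e s)) => es; case: (ltP (e t)) => et //= _.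
      rewrite !ltr0_norm ?subr_lt0 //; lra.
    rewrite !ger0_norm ?subr_ge0 //; lra.
  apply: (Qdis _ _ (e s)); first exact: (eP s).1.
  by rewrite est; exact: (eP t).1.
by apply: (noinj x _ iinj) => t; exact: (hP (i t)).1.
Qed.

End regions.

(** * From hitting perfect sets to fullness *)

Theorem theorem2p8 (R : realType) (E : set R) :
  cb_abundant (@perfect_regions R) E ->
  exists F : set R, ARD F /\ cb_full_subset (@perfect_regions R) F E.
Proof.
move=> _; have [F [ardF FE hit]] := ARD_hitting E.
exists F; split => //; split => // B baB abBE /meager_singular sBF.
have [P [rP PBE]] : exists P, perfect_regions P /\
    forall Q, perfect_regions Q -> Q `<=` P -> Q `&` (B `&` E) !=set0.
  apply: contrapT => noP; apply: abBE; apply: singular_meager => P rP.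
  apply: contrapT => noQ; apply: noP; exists P; split => // Q rQ QP.
  by apply/set0P/eqP => QBE; apply: noQ; exists Q.
have [D [rD DP [/meager_singular|/meager_singular] sD]] := baB P rP.
  (* This case is impossible: every perfect subset of P meets B. *)
  have [D' [rD' D'D D'B]] := sD D rD.
  have [|x [D'x [Bx _]]] := PBE D' rD'; first exact: subset_trans DP.
  by rewrite -[False]/(set0 x) -D'B; split=> //; split=> //; exact: D'D.
have [D1 [rD1 D1D D1B]] := sD D rD.
have {}D1B : D1 `<=` B.
  move=> x D1x; apply: contrapT => nBx.
  by rewrite -[False]/(set0 x) -D1B; split=> //; split=> //; exact: D1D.
(* [D2] lies in B but misses the part of F in B, although F must hit it. *)
have [D2 [rD2 D21 D2F]] := sBF D1 rD1.
have [|x [Fx D2x]] := hit D2 rD2.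
  move=> Q rQ QD2; have [|x [Qx [_ Ex]]] := PBE Q rQ; last by exists x.
  by move=> x /QD2 /D21 /D1D /DP.
by rewrite -[False]/(set0 x) -D2F; split=> //; split=> //; apply/D1B/D21.
Qed.
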